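(* For every constant $\epsilon>0$ there is $\rho=(1/\epsilon)^{O(1)}$ such that, in an arbitrary metric, the $\rho$-swap local search algorithm with centre budget $(1+\epsilon)k$ returns a set $\mathcal S\subseteq\mathcal C$ with $|\mathcal S|\le(1+\epsilon)k$, using at most $z$ outliers, whose cost is at most $(3+\epsilon)\cdot OPT$ for $k$-median-out and at most $(25+\epsilon)\cdot OPT$ for $k$-means-out, where $OPT$ is the optimum cost using at most $k$ centres and at most $z$ outliers.
   Context: Given a finite set $\mathcal X$ of points and a finite set $\mathcal C$ of candidate centres in a metric space with distance $\delta$ (no further assumptions), and integers $k\ge1$, $z\ge0$. For $\emptyset\ne\mathcal S\subseteq\mathcal C$, the $k$-median-out cost is $\min_{Z\subseteq\mathcal X,|Z|\le z}\sum_{x\in\mathcal X\setminus Z}\delta(x,\mathcal S)$ and the $k$-means-out cost is $\min_{Z\subseteq\mathcal X,|Z|\le z}\sum_{x\in\mathcal X\setminus Z}\delta(x,\mathcal S)^2$, with $\delta(x,\mathcal S)=\min_{c\in\mathcal S}\delta(x,c)$. $OPT=\min\{\mathrm{cost}(\mathcal O):\mathcal O\subseteq\mathcal C,|\mathcal O|\le k\}$. The $\rho$-swap local search algorithm with budget $(1+\epsilon)k$: start with an arbitrary $\mathcal S\subseteq\mathcal C$ of $(1+\epsilon)k$ centres; while there exist $P\subseteq\mathcal C\setminus\mathcal S$, $Q\subseteq\mathcal S$ with $|P|,|Q|\le\rho$, $|(\mathcal S\setminus Q)\cup P|\le(1+\epsilon)k$ and $\mathrm{cost}((\mathcal S\setminus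 Q)\cup P)<\mathrm{cost}(\mathcal S)$ (in the polynomial-time version, smaller by at least a factor $(1-\epsilon/|\mathcal C|)$), replace $\mathcal S$ by $(\mathcal S\setminus Q)\cup P$; return $\mathcal S$. *)

(* Defs.v *)
From HB Require Import structures.
From Stdlib Require Import Relation_Operators.
From mathcomp Require Import all_boot all_order all_algebra finmap.
From mathcomp Require Import boolp classical_sets reals topology.

Set Implicit Arguments.
Unset Strict Implicit.
Unset Printing Implicit Defensive.

Import Order.TTheory GRing.Theory Num.Theory.

Local Open Scope fset_scope.
Local Open Scope ring_scope.

(* The minimum of a nonempty finite family; the head is only a starting value
   for the iterated minimum, and the value 0 on the empty list is junk. *)
Definition min_of (R : realType) (s : seq R) : R :=
  \big[Num.min/head 0 s]_(a <- s) a.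

Definition dist_to (R : realType) (T : metricType R)
    (x : T) (S : {fset T}) : R :=
  min_of [seq mdist x c | c <- S].

(* The minimum ranges over the sets Z of discarded points (outliers);
   p is the exponent put on the distances. *)
Definition out_cost (R : realType) (T : metricType R) (p : nat)
    (X : {fset T}) (z : nat) (S : {fset T}) : R :=
  min_of [seq \sum_(x <- X `\` Z) dist_to x S ^+ p
         | Z <- fpowerset X & (#|` Z| <= z)%N].

Definition kmedian_out_cost (R : realType) (T : metricType R) :
  {fset T} -> nat -> {fset T} -> R := @out_cost R T 1.

Definition kmeans_out_cost (R : realType) (T : metricType R) :
  {fset T} -> nat -> {fset T} -> R := @out_cost R T 2.

Definition OPT (R : realType) (T : metricType R) (cost : {fset T} -> R)
    (C : {fset T}) (k : nat) : R :=
  min_of [seq cost A | A <- fpowerset C & (A != fset0) && (#|` A| <= k)%N].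

Definition within_budget (R : realType) (T : metricType R) (eps : R)
    (k : nat) (S : {fset T}) : Prop :=
  (#|` S|)%:R <= (1 + eps) * k%:R.

Inductive variant := Basic | PolyTime.

(* Strict decrease is also required in the PolyTime test, where it matters
   only when the old cost is 0. *)
Definition improves (R : realType) (v : variant) (eps : R) (m : nat)
    (new old : R) : Prop :=
  match v with
  | Basic => new < old
  | PolyTime => new < old /\ new <= (1 - eps / m%:R) * old
  end.

(* (1 + eps) k is rounded down, and capped by the number of candidates. *)
Definition initial (R : realType) (T : metricType R) (eps : R)
    (C : {fset T}) (k : nat) (S : {fset T}) : Prop :=
  S `<=` C /\ #|` S| = minn (Num.truncn ((1 + eps) * k%:R)) #|` C|.

(* The new set is required to be nonempty because the cost of a set of centres
   is only meaningful for nonempty sets. *)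
Definition swap_step (R : realType) (T : metricType R) (v : variant)
    (cost : {fset T} -> R) (eps : R) (rho : nat) (C : {fset T}) (k : nat)
    (S S' : {fset T}) : Prop :=
  exists P Q : {fset T},
    [/\ P `<=` C `\` S, Q `<=` S, (#|` P| <= rho)%N & (#|` Q| <= rho)%N] /\
    [/\ S' = (S `\` Q) `|` P, S' != fset0, within_budget eps k S'
      & improves v eps #|` C| (cost S') (cost S)].

Definition terminates (R : realType) (T : metricType R) (v : variant)
    (cost : {fset T} -> R) (eps : R) (rho : nat) (C : {fset T}) (k : nat) :
    Prop :=
  ~ exists run : nat -> {fset T},
      initial eps C k (run 0%N) /\
      forall i, swap_step v cost eps rho C k (run i) (run i.+1).

(* S is the output of some execution. *)
Definition returned (R : realType) (T : metricType R) (v : variant)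
    (cost : {fset T} -> R) (eps : R) (rho : nat) (C : {fset T}) (k : nat)
    (S : {fset T}) : Prop :=
  exists S0 : {fset T},
    [/\ initial eps C k S0,
        clos_refl_trans {fset T} (swap_step v cost eps rho C k) S0 S
      & ~ exists S', swap_step v cost eps rho C k S S'].

(* Main.v *)
Require Import Defs.
From Stdlib Require Import Relation_Operators.
From mathcomp Require Import all_boot all_order all_algebra finmap.
From mathcomp Require Import zify lra ring.

Set Implicit Arguments.
Unset Strict Implicit.
Unset Printing Implicit Defensive.

(** Let S be locally optimal and O optimal, with outlier sets ZS and ZO. The
    proof tests S against N swaps that together open every centre of O, close
    every centre of S at most once, and never close the centre of S nearest to
    some o in O unless o is open after the swap. In a swap, the points of
    ZO \ ZS served by a closed centre must be discarded, which is paid for by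
    reinstating at least as many points of ZS \ ZO, whose optimal centres must
    be open. Adding up the N inequalities "the swap does not help" gives
    cost(S) <= cost(O) + sum over the common inliers of
    (2 dO + dS)^p - dS^p, up to the slack of the polynomial-time rule; this
    yields the factor 3 for p = 1 and, after AM-GM, 25 for p = 2.

    The swaps are built in two stages. Sorting O by nearest centre in S and
    cutting the list into groups of h spoils only about k/h centres of S (those
    nearest to members of two groups), which are never closed; the eps k extra
    centres allow each group of size q to be matched with q + 1 centres of S.
    The groups then have arbitrary surpluses and deficits of reinstated minus
    discarded points; taking a deficit group while the running balance is
    nonnegative, and a surplus group otherwise, they are merged into chunks of
    about w groups. At a chunk boundary either one deficit group keeps its centres
    of S open, or one surplus group has its centres of O opened again in the
    next chunk; the extra centre of each group pays for this once w > 2 h. *)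

(** * Construction of the test swaps *)

(** Greedy completion by induction on the unassigned set: while some capacity is not exhausted, one
    more element goes there. It serves once for the slots of S that no centre of O prefers, and once
    for the outliers of O that no closed slot forces out. *)
Lemma fill_capacity (Y I : finType) (F : {set Y}) (f : Y -> option I)
    (c : I -> nat) :
  {in F, forall y, f y = None} ->
  (forall t, #|[set y | f y == Some t]| <= c t) ->
  exists f' : Y -> option I,
    [/\ forall y, y \notin F -> f' y = f y,
        forall t, #|[set y | f' y == Some t]| <= c t
      & {in F, forall y, f' y != None}
        \/ forall t, #|[set y | f' y == Some t]| = c t].
Proof.
elim: {F}#|F| {-2}F (erefl #|F|) f => [|n IH] F cF f fF fc.
  exists f; split=> //; left=> y; by rewrite (cards0_eq cF) inE.
case: (altP (@forallP _ (fun t => #|[set y | f y == Some t]| == c t))) => [eqc|].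
  by exists f; split=> //; right=> t; apply/eqP.
rewrite negb_forall => /existsP [t nt].
have /card_gt0P [y yF] : 0 < #|F| by rewrite cF.
pose f1 y' := if y' == y then Some t else f y'.
have c1 : #|F :\ y| = n by move: cF; rewrite (cardsD1 y) yF; case.
have [|t'|f' [f'1 f'2 f'3]] := IH _ c1 f1.
- by move=> y'; rewrite !inE /f1 => /andP [/negbTE -> /fF].
- have [->|ntt'] := eqVneq t' t.
    have lt : #|[set y | f y == Some t]| < c t by rewrite ltn_neqAle nt fc.
    apply: leq_trans lt.
    have := cardsU1 y [set y | f y == Some t].
    rewrite inE fF //= add1n => <-; apply: subset_leq_card.
    by apply/subsetP=> y'; rewrite !inE /f1; case: (y' == y).
  apply: leq_trans (fc t'); apply: subset_leq_card; apply/subsetP=> y'.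
  rewrite !inE /f1; case: (y' == y) => // /eqP [ett'];
    by rewrite ett' eqxx in ntt'.
- exists f'; split=> //.
    move=> y' ny'; rewrite f'1 ?inE ?(negbTE ny') ?andbF // /f1.
    by case: eqP ny' => // ->; rewrite yF.
  case: f'3 => [f'3|]; [left=> y' y'F | by right].
  have [->|ne] := eqVneq y' y; last by apply: f'3; rewrite !inE ne.
  by rewrite f'1 ?inE ?eqxx // /f1 eqxx.
Qed.

(** The groups are the blocks of length [h] in an enumeration sorted by [phi]. Fibres are then
    intervals, so a fibre meeting two blocks contains the first element of the later one; hence
    there are at most as many such fibres as blocks. *)
Lemma fibre_grouping (I J : finType) (phi : I -> J) (h : nat) : 0 < h ->
  exists g : I -> 'I_(#|I| %/ h).+1,
    (forall t, #|[set i | g i == t]| <= h) /\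
    #|[set j | [exists i, [exists i',
        [&& phi i == j, phi i' == j & g i != g i']]]]| <= (#|I| %/ h).+1.
Proof.
move=> h0.
pose r i i' := enum_rank (phi i) <= enum_rank (phi i').
pose s := sort r (enum I).
have rtot : total r by move=> i i'; apply: leq_total.
have rtr : transitive r by move=> i i' i''; apply: leq_trans.
have ss : sorted r s by apply: sort_sorted.
have sz : size s = #|I| by rewrite size_sort -cardE.
have us : uniq s by rewrite sort_uniq enum_uniq.
have ins i : i \in s by rewrite mem_sort mem_enum.
have ltix i : index i s < #|I| by rewrite -sz index_mem.
have gP i : index i s %/ h < (#|I| %/ h).+1.
  by rewrite ltnS leq_div2r // ltnW.
exists (fun i => Ordinal (gP i)); split=> [t|].
  have inj : {in [set i | Ordinal (gP i) == t] &,
      injective (fun i => Ordinal (ltn_pmod (index i s) h0))}.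
    move=> i i'; rewrite !inE -!val_eqE /= => /eqP e /eqP e' [e2].
    apply: (index_inj i (ins i) (ins i')).
    by rewrite (divn_eq (index i s) h) (divn_eq (index i' s) h) e e' e2.
  by rewrite -(card_in_imset inj) -[leqRHS]card_ord max_card.
case: (posnP #|I|) => [I0|Ipos].
  rewrite (_ : [set j | _] = set0) ?cards0 //.
  apply/setP=> j; rewrite !inE; apply/negbTE/negP=> /existsP [i _].
  by have := ltix i; rewrite I0.
have /card_gt0P [i0 _] := Ipos.
apply: leq_trans (_ : #|[set phi (nth i0 s (t * h)) | t : 'I_(#|I| %/ h).+1]| <= _); last first.
  by apply: leq_trans (leq_imset_card _ _) _; rewrite card_ord.
apply: subset_leq_card; apply/subsetP=> j; rewrite inE.
have key i i' : phi i = j -> phi i' = j -> index i s %/ h < index i' s %/ h ->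
    j \in [set phi (nth i0 s (t * h)) | t : 'I_(#|I| %/ h).+1].
  move=> e e' lt; apply/imsetP; exists (Ordinal (gP i')) => //=.
  set b := _ * h.
  have b1 : index i s <= b.
    have := ltn_ceil (index i s) h0; rewrite /b; nia.
  have b2 : b <= index i' s := leq_divM _ _.
  have b3 : b < size s by rewrite sz; apply: leq_ltn_trans b2 _.
  have mono x y : x <= y -> y < size s -> r (nth i0 s x) (nth i0 s y).
    by move=> xy ys; apply: (sorted_leq_nth rtr) => //;
      rewrite ?inE //; [move=> z; rewrite /r | apply: leq_ltn_trans ys].
  have m1 := mono _ _ b1 b3.
  have m2 := mono _ _ b2; rewrite sz ltix in m2; have {}m2 := m2 isT.
  rewrite !nth_index // /r e e' in m1 m2.
  by apply: enum_rank_inj; apply: val_inj; apply: anti_leq; rewrite m1 m2.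
move=> /existsP [i /existsP [i' /and3P [/eqP e /eqP e']]].
rewrite -val_eqE /= neq_ltn => /orP [] lt;
  [exact: (key i i') | exact: (key i' i)].
Qed.

(* Greedy order: a group with A > B is taken while the balance is nonnegative,
   a group with A < B otherwise. In the second alternative the balance is
   negative because of e alone. *)
Lemma balanced_selection (G : finType) (A B : G -> nat) (Gam : {set G})
    (b j : nat) :
  j <= #|Gam| -> \sum_(g in Gam) A g <= \sum_(g in Gam) B g + b ->
  exists2 T : {set G}, T \subset Gam & #|T| = j /\
    ((\sum_(g in T) A g <= \sum_(g in T) B g + b /\
      [\/ \sum_(g in T) B g <= \sum_(g in T) A g,
          exists2 c, c \in T & \sum_(g in T) B g + b <= \sum_(g in T) A g + B c
        | {in Gam :\: T, forall g, A g <= B g}])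
     \/ exists2 e, e \in T
         & \sum_(g in T :\ e) A g <= \sum_(g in T :\ e) B g + b
           /\ \sum_(g in T) B g + b < \sum_(g in T) A g).
Proof.
move=> + AB; elim: j => [_|j IH jG].
  exists set0; first exact: sub0set.
  by rewrite cards0 !big_set0; split=> //; left; split=> //; apply: Or31.
have [T TG [cT H]] := IH (ltnW jG).
have split_sum (F : G -> nat) : \sum_(g in Gam) F g
    = \sum_(g in T) F g + \sum_(g in Gam :\: T) F g.
  by rewrite (big_setID T) /= (setIidPr TG).
have add g (F : G -> nat) : g \in Gam :\: T ->
    \sum_(x in g |: T) F x = F g + \sum_(x in T) F x.
  by rewrite inE => /andP [gT _]; rewrite big_setU1.
have addP g : g \in Gam :\: T -> g |: T \subset Gam /\ #|g |: T| = j.+1.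
  rewrite inE => /andP [gT gG]; rewrite cardsU1 gT cT add1n; split=> //.
  by apply/subsetP=> x; rewrite !inE => /orP [/eqP ->|/(subsetP TG)].
have [g0 g0P] : exists g, g \in Gam :\: T.
  apply/card_gt0P; rewrite cardsD (setIidPr TG); lia.
case: H => [[AT H]|[e eT [AT BT]]].
  case: (boolP [exists g, (g \in Gam :\: T) && (B g < A g)]); last first.
    rewrite negb_exists => /forallP nd.
    have nd' : {in Gam :\: T, forall g, A g <= B g}.
      by move=> g gP; have := nd g; rewrite gP /= -leqNgt.
    have [s c] := addP _ g0P; exists (g0 |: T) => //; split=> //; left.
    rewrite !add //; split; first by have := nd' _ g0P; lia.
    by apply: Or33 => g; rewrite !inE negb_or -andbA => /and3P [_ gT gG];
      apply: nd'; rewrite inE gT.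
  case/existsP=> g /andP [gP lt]; have [s c] := addP _ gP.
  exists (g |: T) => //; split=> //.
  case: (leqP (\sum_(x in g |: T) A x) (\sum_(x in g |: T) B x + b)) => le.
    left; split=> //; case: H => [H|[x xT H]|/(_ _ gP)]; last lia.
      by apply: Or31; rewrite !add //; lia.
    by apply: Or32; exists x; rewrite ?inE ?xT ?orbT // !add //; lia.
  right; exists g; first by rewrite !inE eqxx.
  suff -> : (g |: T) :\ g = T by split.
  by rewrite setU1K //; move: gP; rewrite inE => /andP [].
(* The selected groups are in deficit although the total is not, so a surplus group must remain. *)
have [g gP lt] : exists2 g, g \in Gam :\: T & A g < B g.
  case: (boolP [exists g, (g \in Gam :\: T) && (A g < B g)]).
    by case/existsP=> g /andP []; exists g.
  rewrite negb_exists => /forallP nd.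
  have : \sum_(g in Gam :\: T) B g <= \sum_(g in Gam :\: T) A g.
    by apply: leq_sum => g gP; have := nd g; rewrite gP /= -leqNgt.
  by move: AB; rewrite !split_sum; lia.
have [s c] := addP _ gP; exists (g |: T) => //; split=> //.
have gT : g \notin T by move: gP; rewrite inE => /andP [].
(* Either the balance stays negative and [e] is still to blame, or [g] made it nonnegative and what
   is left over is at most [B g]. *)
case: (ltnP (\sum_(x in g |: T) B x + b) (\sum_(x in g |: T) A x)) => le.
  right; exists e; first by rewrite !inE eT orbT.
  split=> //; have ge : e != g by apply: contraNneq gT => <-.
  have -> : (g |: T) :\ e = g |: (T :\ e).
    by apply/setP=> x; rewrite !inE; have [->|] := eqVneq x g;
      rewrite ?andbT //= eq_sym.
  by rewrite !big_setU1 ?inE ?(negbTE gT) ?andbF //=; lia.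
left; split=> //; apply: Or32; exists g; first by rewrite !inE eqxx.
by rewrite !add //; lia.
Qed.

Lemma subset_of_card (T : finType) (W : {set T}) (n : nat) : n <= #|W| ->
  exists2 V : {set T}, V \subset W & #|V| = n.
Proof.
move=> nW; exists [set x in take n (enum W)].
  by apply/subsetP=> x; rewrite inE => /mem_take; rewrite mem_enum.
rewrite cardsE; have /card_uniqP -> : uniq (take n (enum W)).
  by rewrite take_uniq ?enum_uniq.
by rewrite size_takel // -cardE.
Qed.

(* W holds the reinstated points that earlier chunks have left over; they all
   lie in one group c, so that using them reopens a single group. U is the group
   that is not closed, W' and c' are handed to the next chunk. *)
Lemma carry_selection (G X : finType) (Y : {set X}) (gr : X -> G)
    (A : G -> nat) (w : nat) (Gam : {set G}) (W : {set X}) (c : G) :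
  let B g := #|[set x in Y | gr x == g]| in
  w <= #|Gam| -> W \subset [set x in Y | gr x == c] ->
  {in W, forall x, gr x \notin Gam} ->
  \sum_(g in Gam) A g <= \sum_(g in Gam) B g + #|W| ->
  exists (T U : {set G}) (W' : {set X}) (c' : G),
    [/\ T \subset Gam, #|T| = w, U \subset T & #|U| <= 1] /\
    [/\ W' \subset [set x in Y | gr x == c'],
        W' \subset W :|: [set x in Y | gr x \in T],
        \sum_(g in T :\: U) A g
          <= #|(W :|: [set x in Y | gr x \in T]) :\: W'|
      & \sum_(g in Gam :\: T) A g <= \sum_(g in Gam :\: T) B g + #|W'|].
Proof.
move=> B wG Wc WG AB; have [T TG [cT H]] := balanced_selection wG AB.
have split_sum (F : G -> nat) : \sum_(g in Gam) F g
    = \sum_(g in T) F g + \sum_(g in Gam :\: T) F g.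
  by rewrite (big_setID T) /= (setIidPr TG).
have cZ : #|[set x in Y | gr x \in T]| = \sum_(g in T) B g.
  rewrite -sum1_card (partition_big gr (mem T)) /=; last first.
    by move=> x; rewrite inE => /andP [].
  apply: eq_bigr => g gT; rewrite /B -sum1_card; apply: eq_bigl => x.
  by rewrite !inE; case: eqP => [->|]; rewrite ?gT ?andbT ?andbF.
have cWZ : #|W :|: [set x in Y | gr x \in T]| = #|W| + \sum_(g in T) B g.
  rewrite cardsU cZ (_ : W :&: _ = set0) ?cards0 ?subn0 //.
  apply/setP=> x; rewrite !inE; apply/negbTE/negP=> /and3P [xW _ xT].
  by have := WG _ xW; rewrite (subsetP TG).
have cD (W' : {set X}) : W' \subset W :|: [set x in Y | gr x \in T] ->
    #|(W :|: [set x in Y | gr x \in T]) :\: W'|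
    = #|W| + \sum_(g in T) B g - #|W'|.
  by move=> s; rewrite cardsD (setIidPr s) cWZ.
rewrite !split_sum in AB.
case: H => [[AT H]|[e eT [AT BT]]]; last first.
  (* Deficit case: the centres of S matched with [e] stay open, and all available points are
     spent. *)
  exists T, [set e], set0, c; rewrite cards1 sub1set eT !sub0set; split=> //.
  split=> //; last by rewrite cards0; lia.
  rewrite cD ?sub0set // cards0 subn0.
  have eB : \sum_(g in T) B g = B e + \sum_(g in T :\ e) B g.
    by rewrite (big_setD1 e).
  by move: AT; rewrite eB; lia.
exists T, set0; rewrite setD0.
(* What is left over is taken from [W] when it fits there, or from the points of [c']; in the third
   case no remaining group is in deficit and nothing is handed on. *)
case: H => [H|[c' c'T H]|H].
- have [W' W'W cW'] := @subset_of_card _ W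
    (#|W| + \sum_(g in T) B g - \sum_(g in T) A g) ltac:(lia).
  have W's : W' \subset W :|: [set x in Y | gr x \in T].
    exact: subset_trans W'W (subsetUl _ _).
  exists W', c; rewrite sub0set cards0; split=> //; rewrite cD // cW'.
  by split=> //; [exact: subset_trans Wc | lia | lia].
- have [W' W'W cW'] := @subset_of_card _ [set x in Y | gr x == c']
    (#|W| + \sum_(g in T) B g - \sum_(g in T) A g) ltac:(rewrite -/(B c'); lia).
  have W's : W' \subset W :|: [set x in Y | gr x \in T].
    apply/subsetP=> x /(subsetP W'W); rewrite !inE => /andP [-> /eqP ->].
    by rewrite c'T orbT.
  exists W', c'; rewrite sub0set cards0; split=> //; rewrite cD // cW'.
  by split=> //; lia.
exists set0, c; rewrite !sub0set !cards0; split=> //; split=> //.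
  by rewrite cD ?sub0set // cards0; lia.
by rewrite addn0; apply: leq_sum.
Qed.

(** Chunks of exactly [w] groups are peeled off until fewer than [w.*2] groups remain, which form
    one chunk. [U] collects the groups whose centres of S are not closed; the [c'] of a chunk is the
    one group from which it may use points handed over. *)
Lemma chunking (G X : finType) (Y : {set X}) (gr : X -> G)
    (A : G -> nat) (w : nat) (Gam : {set G}) (W : {set X}) (c : G) :
  0 < w -> w <= #|Gam| -> W \subset [set x in Y | gr x == c] ->
  {in W, forall x, gr x \notin Gam} ->
  \sum_(g in Gam) A g
    <= \sum_(g in Gam) #|[set x in Y | gr x == g]| + #|W| ->
  exists (N : nat) (chi : G -> nat) (U : {set G}) (om : X -> nat),
    let V := W :|: [set x in Y | gr x \in Gam] in
    [/\ N * w <= #|Gam|, {in Gam, forall g, chi g < N},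
        {in V, forall x, om x < N}
      & forall t, t < N ->
        [/\ w <= #|[set g in Gam | chi g == t]| < w.*2,
            #|[set g in Gam :&: U | chi g == t]| <= 1,
            \sum_(g in Gam :\: U | chi g == t) A g
              <= #|[set x in V | om x == t]|
          & exists c', {in V, forall x, om x = t ->
              (gr x \in Gam) && (chi (gr x) == t) || (gr x == c')}]].
Proof.
move=> w0; elim: {Gam}#|Gam| {-2}Gam (leqnn #|Gam|) W c => [|n IH] Gam cG W c.
  lia.
move=> wG Wc WG AB.
case: (ltnP #|Gam| w.*2) => G2.
  exists 1, (fun=> 0), set0, (fun=> 0); split; rewrite ?mul1n //.
  move=> t; rewrite ltnS leqn0 => /eqP ->; split.
  - rewrite (_ : [set g in Gam | _] = Gam) ?wG //.
    by apply/setP=> g; rewrite inE andbT.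
  - by rewrite setI0 (_ : [set g in set0 | _] = set0) ?cards0 //;
      apply/setP=> g; rewrite !inE.
  - rewrite setD0; under eq_bigl do rewrite andbT.
    apply: leq_trans AB _.
    rewrite [X in _ <= #|pred_of_set X|](_ : _ = W :|: [set x in Y | gr x \in Gam]); last first.
      by apply/setP=> x; rewrite !inE eqxx andbT.
    rewrite cardsU (_ : W :&: _ = set0) ?cards0 ?subn0.
      rewrite addnC leq_add2l -[leqRHS]sum1_card (partition_big gr (mem Gam)) /=; last first.
        by move=> x; rewrite inE => /andP [].
      apply: leq_sum => g gT; rewrite -sum1_card; apply: eq_leq;
        apply: eq_bigl => x.
      by rewrite !inE; case: eqP => [->|]; rewrite ?gT ?andbT ?andbF.
    apply/setP=> x; rewrite !inE; apply/negbTE/negP=> /and3P [xW _ xT].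
    by have := WG _ xW; rewrite xT.
  - exists c => x;
    rewrite !inE eqxx andbT => /orP [/(subsetP Wc)|/andP [_ ->]//].
    by rewrite inE => /andP [_ ->]; rewrite orbT.
have [T [U0 [W' [c' [[TG cT UT cU] [W'c W's AT AG]]]]]] :=
  carry_selection wG Wc WG AB.
have cGT : #|Gam :\: T| = #|Gam| - w by rewrite cardsD (setIidPr TG) cT.
have [||//||//|N [chi [U [om [Nw chiN omN H]]]]] := IH (Gam :\: T) _ W' c'.
- by rewrite cGT; lia.
- by rewrite cGT; lia.
- move=> x /(subsetP W's); rewrite !inE => /orP [/WG /negbTE ->|/andP [_ ->]//].
  by rewrite andbF.
set V' := W' :|: _ in omN H.
pose Wt := (W :|: [set x in Y | gr x \in T]) :\: W'.
pose V := W :|: [set x in Y | gr x \in Gam].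
have VV' x : x \in V -> x \notin Wt -> x \in V'.
  rewrite !inE; case: (x \in W') => //=; case: (x \in W) => //=.
  by case: (x \in Y) => //= ->; rewrite andbT.
have V'Wt x : x \in V' -> x \notin Wt.
  rewrite !inE; case xW': (x \in W') => //= /and3P [xY xT xG].
  rewrite negb_or negb_and xT orbT andbT.
  by apply: contraL xG => /WG.
have V'V x : x \in V' -> x \in V.
  rewrite !inE => /orP [/(subsetP W's)|/and3P [-> _ ->]]; last by rewrite orbT.
  by rewrite !inE => /orP [->//|/andP [-> /(subsetP TG) ->]]; rewrite orbT.
have WtV x : x \in Wt -> x \in V.
  by rewrite !inE => /andP [_ /orP [->//|/andP [-> /(subsetP TG) ->]]];
    rewrite orbT.
(* The peeled chunk gets the number [N], since the recursive call uses the numbers below [N]. *)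
exists N.+1, (fun g => if g \in T then N else chi g), (U0 :|: U :\: T),
  (fun x => if x \in Wt then N else om x).
split.
- by rewrite mulSn; lia.
- move=> g gG; case: ifP => // gT; apply: ltnW; apply: chiN.
  by rewrite inE gT.
- move=> x xV; case: ifPn => // xW; apply: ltnW; apply: omN; exact: VV'.
move=> t; rewrite ltnS leq_eqVlt => /orP [/eqP ->|tN].
  have chiT g : g \in Gam -> ((if g \in T then N else chi g) == N) = (g \in T).
    move=> gG; case: ifP => [|gT]; first by rewrite eqxx.
    by apply: ltn_eqF; apply: chiN; rewrite inE gT.
  have omT x : x \in V -> ((if x \in Wt then N else om x) == N) = (x \in Wt).
    move=> xV; case: ifPn => [|xW]; first by rewrite eqxx.
    by apply: ltn_eqF; apply: omN; exact: VV'.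
  have Tset : [set g in Gam | (if g \in T then N else chi g) == N] = T.
    apply/setP=> g; rewrite inE; case: (boolP (g \in Gam)) => [/chiT -> //|gG].
    by apply/esym/negbTE; apply: contra gG => /(subsetP TG).
  split.
  - by rewrite Tset cT leqnn -addnn; lia.
  - apply: leq_trans cU; apply: subset_leq_card; apply/subsetP=> g.
    rewrite 3!inE => /andP [/andP [gG]] + gt; rewrite chiT // in gt.
    by rewrite !inE gt orbF.
  - apply: leq_trans (_ : #|Wt| <= _).
      apply: leq_trans AT; apply: eq_leq; apply: eq_bigl => g; rewrite 2!inE.
      case: (boolP (g \in Gam)) => [gG|gG]; rewrite ?andbF.
        rewrite chiT // andbT !inE; case: (g \in T); rewrite ?andbF //=.
        by rewrite orbF.
      apply/esym/negbTE; rewrite inE negb_and.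
      by rewrite (contra (subsetP TG g) gG) orbT.
    apply: subset_leq_card; apply/subsetP=> x xW; rewrite inE -/V WtV //=.
    by rewrite xW.
  - exists c => x xV /eqP; rewrite omT // => xW.
    move: xW; rewrite !inE => /andP [_ /orP [/(subsetP Wc)|/andP [_ xT]]].
      by rewrite inE => /andP [_ ->]; rewrite orbT.
    by rewrite xT (subsetP TG) // eqxx.
have [H1 H2 H3 [c2 H4]] := H _ tN.
have chiT g : (g \in Gam) && ((if g \in T then N else chi g) == t)
    = (g \in Gam :\: T) && (chi g == t).
  by rewrite inE; case: ifP => //=; rewrite gtn_eqF // andbF.
have chiS : [set g in Gam | (if g \in T then N else chi g) == t]
    = [set g in Gam :\: T | chi g == t].
  by apply/setP=> g; rewrite inE chiT inE.
split.
- by rewrite chiS.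
- apply: leq_trans H2; apply: subset_leq_card; apply/subsetP=> g.
  rewrite inE => /andP [/setIP [gG gU] e].
  move: (chiT g); rewrite gG e => /esym /andP [gT e'].
  rewrite inE e' andbT inE gT; move: gU gT.
  by rewrite !inE => /orP [/(subsetP UT) ->//|/andP [_ ->]].
- have -> : [set x in V | (if x \in Wt then N else om x) == t]
      = [set x in V' | om x == t].
    apply/setP=> x; rewrite inE [RHS]inE.
    case: (boolP (x \in Wt)) => xW.
      rewrite gtn_eqF // andbF; apply/esym/negbTE; rewrite negb_and.
      by rewrite (contraL (V'Wt x) _).
    congr andb; apply/idP/idP; [by move/VV'; apply | exact: V'V].
  apply: leq_trans H3; apply: eq_leq; apply: eq_bigl => g.
  rewrite inE -andbA chiT !inE; case: (boolP (g \in T));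
    rewrite ?andbF //= => gT.
  by rewrite (negbTE (contra (subsetP UT g) gT)) /= andbA.
- exists c2 => x xV; case: ifPn => [_ e|xW /(H4 _ (VV' _ xV xW))].
    by rewrite -e ltnn in tN.
  by rewrite inE => /orP [/andP [/andP [/negbTE -> ->] ->]|->]; rewrite ?orbT.
Qed.

Lemma sum_card_some (Y I : finType) (f : Y -> option I) :
  \sum_t #|[set y | f y == Some t]| = #|[set y | f y != None]|.
Proof.
rewrite -[RHS]sum1_card [RHS](eq_bigl (fun y => f y != None)); last first.
  by move=> y; rewrite inE.
under eq_bigr do rewrite -sum1_card.
rewrite (exchange_big_dep (fun y => f y != None)) /=; last first.
  by move=> t y _; rewrite inE => /eqP ->.
apply: eq_bigr => y; case e: (f y) => [t|] // _.
rewrite (eq_bigl (pred1 t)) ?big_pred1_eq // => t'.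
by rewrite inE e /= eq_sym.
Qed.

Lemma sum_card_fibre (X G : finType) (gr : X -> G) (Y : {set X}) (p : pred G) :
  \sum_(g | p g) #|[set x in Y | gr x == g]| = #|[set x in Y | p (gr x)]|.
Proof.
rewrite -[RHS]sum1_card (partition_big gr p) /=; last first.
  by move=> x; rewrite inE => /andP [].
apply: eq_bigr => g gT; rewrite -sum1_card; apply: eq_bigl => x.
by rewrite !inE; case: eqP => [->|]; rewrite ?gT ?andbT ?andbF.
Qed.

Lemma leq_sum_eq (I : finType) (a b : I -> nat) :
  (forall t, a t <= b t) -> \sum_t b t <= \sum_t a t -> forall t, a t = b t.
Proof.
move=> le sle t; apply/eqP; rewrite eqn_leq le /=.
move: sle; rewrite (bigD1 t) //= [X in _ <= X](bigD1 t) //=.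
have : \sum_(i | i != t) a i <= \sum_(i | i != t) b i by apply: leq_sum.
lia.
Qed.

(* [kap j = Some t] means that j may be closed together with group t. The
   allocation of a surplus slot to its group is unconstrained, because no i has
   it as its nearest slot. *)
Lemma slot_allocation (I J : finType) (phi : I -> J) (h : nat) :
  0 < h -> let n := (#|I| %/ h).+1 in #|I| + n.*2 <= #|J| ->
  exists (g : I -> 'I_n) (kap : J -> option 'I_n),
    [/\ forall t, #|[set i | g i == t]| <= h,
        forall t, #|[set j | kap j == Some t]| = #|[set i | g i == t]|.+1
      & forall i t, kap (phi i) = Some t -> g i = t].
Proof.
move=> h0 n IJ; have [g [gh gs]] := fibre_grouping phi h0; exists g.
set spl := [set j | _] in gs.
(* A nearest slot outside [spl] goes to the only group that prefers it. The slots in [F] are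
   nobody's nearest and are distributed freely. *)
pose k0 j := if j \in spl then None else
  if [pick i | phi i == j] is Some i then Some (g i) else None.
pose F := [set j | (j \notin spl) && ([pick i | phi i == j] == None)].
have [||k [k1 k2 k3]] := @fill_capacity J 'I_n F k0 (fun t => #|[set i | g i == t]|.+1).
- by move=> j; rewrite inE /k0 => /andP [/negbTE -> /eqP ->].
- move=> t; apply: leqW.
  apply: leq_trans (_ : #|phi @: [set i | g i == t]| <= _);
    last exact: leq_imset_card.
  apply: subset_leq_card; apply/subsetP=> j; rewrite inE /k0; case: ifP => // _.
  case: pickP => // i /eqP <- /eqP [<-]; by apply: imset_f; rewrite inE.
exists k; split=> //.
  (* If all of [F] is assigned, only [spl] is not, so at least [#|I| + n] slots are assigned. This
     equals the total capacity, which forces equality in every group. *)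
  case: k3 => // k3; apply: leq_sum_eq => //.
  rewrite sum_card_some.
  under eq_bigr do rewrite -addn1.
  rewrite big_split /= sum1_card card_ord.
  have -> : \sum_(t < n) #|[set i | g i == t]| = #|I|.
    rewrite -[RHS]sum1_card (partition_big g predT) //=.
    by apply: eq_bigr => t _; rewrite -sum1_card; apply: eq_bigl => i;
      rewrite inE.
  have : #|~: spl| <= #|[set y | k y != None]|.
    apply: subset_leq_card; apply/subsetP=> j; rewrite !inE => js.
    case: (boolP (j \in F)) => jF; first exact: k3.
    rewrite k1 // /k0 inE (negbTE js); move: jF; rewrite !inE js /=.
    by case: [pick i | _].
  rewrite cardsCs setCK => H; apply: leq_trans H; move: IJ gs;
    rewrite -/n -addnn; lia.
move=> i t; case: (boolP (phi i \in F)) => iF.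
  by move: iF; rewrite inE; case: pickP => [i' _|/(_ i)]; rewrite ?eqxx ?andbF.
rewrite k1 // /k0; case: ifPn => // ns; case: pickP => // i' e [<-].
move: ns; rewrite inE negb_exists => /forallP /(_ i).
rewrite negb_exists => /forallP /(_ i'); rewrite eqxx e /=.
by rewrite negbK => /eqP.
Qed.

(* X are the points, I the slots of O and J the slots of S; [om x] is the swap
   in which the outlier x of S is reinstated, [D x] the one in which the outlier
   x of O is discarded. *)
Lemma swap_family (X I J : finType) (o : X -> I) (s : X -> J) (phi : I -> J)
    (ZS ZO : {set X}) (h w : nat) :
  let n := (#|I| %/ h).+1 in
  0 < h -> #|ZO| <= #|ZS| -> #|I| + n.*2 <= #|J| -> h.*2 < w -> w <= n ->
  exists (N : nat) (P : 'I_N -> {set I}) (Q : 'I_N -> {set J})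
      (tau : I -> 'I_N) (om D : X -> 'I_N),
    [/\ N * w <= n,
        forall t, #|P t| <= #|Q t|,
        forall t, #|Q t| <= w.*2 * h.+1
      & forall t, #|[set x in ZO :\: ZS | D x == t]|
                  <= #|[set x in ZS :\: ZO | om x == t]|] /\
    [/\ forall i, i \in P (tau i),
        forall j t t', j \in Q t -> j \in Q t' -> t = t',
        forall i t, phi i \in Q t -> i \in P t,
        {in ZS :\: ZO, forall x, o x \in P (om x)}
      & {in ZO :\: ZS, forall x t, s x \in Q t -> D x = t}].
Proof.
move=> n h0 cZ IJ hw wn.
have [g [kap [gh kapc kapP]]] := slot_allocation phi h0 IJ.
(* The outliers of O that have to be discarded when the slots of group [t] are closed. *)
pose A t := #|[set x in ZO :\: ZS | kap (s x) == Some t]|.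
have cD : #|ZO :\: ZS| <= #|ZS :\: ZO|.
  by rewrite !cardsD [ZS :&: ZO]setIC; lia.
have [|||||N [chi [U [om [Nw chiN omN H]]]]] :=
  @chunking _ X (ZS :\: ZO) (g \o o) A w setT set0 ord0.
- by lia.
- by rewrite cardsT card_ord.
- exact: sub0set.
- by move=> x; rewrite inE.
- rewrite cards0 addn0 (sum_card_fibre (g \o o)).
  apply: leq_trans (_ : #|ZO :\: ZS| <= _); last first.
    by apply: leq_trans cD _; apply: subset_leq_card;
      apply/subsetP=> x; rewrite inE => ->; rewrite inE.
  rewrite /A; under eq_bigr do rewrite -sum1_card.
  rewrite (exchange_big_dep (fun x => x \in ZO :\: ZS)) /=; last first.
    by move=> t x _; rewrite inE => /andP [].
  rewrite -[leqRHS]sum1_card; apply: leq_sum => x xZ.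
  case e: (kap (s x)) => [t|]; last first.
    by rewrite big1 // => t; rewrite !inE e andbF.
  rewrite (eq_bigl (pred1 t)) ?big_pred1_eq // => t'.
  by rewrite inE inE xZ e /= eq_sym.
have {}omN : {in ZS :\: ZO, forall x, om x < N}.
  by move=> x xZ; apply: omN; rewrite in_setU inE xZ !inE.
have {}chiN t : chi t < N by apply: chiN; rewrite inE.
case: N Nw chiN omN H => [_ /(_ ord0) //|N Nw chiN omN H].
pose Gt (t : 'I_N.+1) := [set a : 'I_n | chi a == t].
(* Besides its own groups, a swap opens the optimal centres of the points that it reinstates; these
   may lie in one further group. *)
pose P (t : 'I_N.+1) := [set i | chi (g i) == t]
  :|: o @: [set x in ZS :\: ZO | om x == t].
pose Q (t : 'I_N.+1) :=
  [set j | if kap j is Some a then (a \notin U) && (chi a == t) else false].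
pose omo x : 'I_N.+1 := inord (om x).
have omoE (t : 'I_N.+1) : [set x in ZS :\: ZO | omo x == t] = [set x in ZS :\: ZO | om x == t].
  apply/setP=> x; rewrite inE [RHS]inE; case: (boolP (x \in _)) => //= xZ.
  by rewrite -val_eqE /= inordK // omN.
have {H} H (t : 'I_N.+1) : [/\ w <= #|Gt t| < w.*2,
    #|[set a in U | chi a == t]| <= 1,
    \sum_(a in ~: U | chi a == t) A a <= #|[set x in ZS :\: ZO | om x == t]|
  & exists c, P t \subset [set i | chi (g i) == t] :|: [set i | g i == c]].
  have [H1 H2 H3 [c H4]] := H t (ltn_ord t).
  have VE x : (x \in set0 :|: [set x0 in ZS :\: ZO | (g \o o) x0 \in [set: 'I_n]])
      = (x \in ZS :\: ZO) by rewrite !inE andbT.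
  split.
  - rewrite /Gt (_ : [set a | _] = [set a in setT | chi a == t]) //.
    by apply/setP=> a; rewrite !inE.
  - rewrite (_ : [set a in U | _] = [set a in setT :&: U | chi a == t]) //.
    by rewrite setTI.
  - rewrite (_ : [set x in ZS :\: ZO | _] = [set x in
      set0 :|: [set x0 in ZS :\: ZO | (g \o o) x0 \in [set: 'I_n]] | om x == t]).
      by apply: leq_trans H3; rewrite setTD.
    by apply/setP=> x; rewrite inE [RHS]inE VE.
  exists c; apply/subsetP=> i /setUP [iP|/imsetP [x]].
    by apply/setUP; left.
  rewrite inE => /andP [xZ /eqP xt] ->.
  have := H4 x; rewrite VE => /(_ xZ xt); by rewrite !inE.
(* [D0] records the forced discards. The other outliers of O are then placed wherever reinstated
   points leave room. *)
pose D0 x : option 'I_N.+1 := if x \in ZO :\: ZS then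
  if kap (s x) is Some a then if a \in U then None else Some (inord (chi a))
  else None else None.
have [||D [D1 D2 D3]] := @fill_capacity X 'I_N.+1
   [set x in ZO :\: ZS | D0 x == None] D0 (fun t => #|[set x in ZS :\: ZO | om x == t]|).
- by move=> x; rewrite inE => /andP [_ /eqP].
- move=> t; have [_ _ H3 _] := H t; apply: leq_trans H3.
  rewrite -sum1_card (partition_big (fun x => odflt ord0 (kap (s x)))
    (fun a => (a \in ~: U) && (chi a == t))) /=.
    apply: leq_sum => a _; rewrite sum1_card; apply: subset_leq_card.
    apply/subsetP=> x; rewrite unfold_in => /andP [+ /eqP]; rewrite inE /D0.
    case: (boolP (x \in _)) => // xZ; case e: (kap (s x)) => [a'|] //= _ <-.
    by rewrite inE xZ e eqxx.
  move=> x; rewrite inE /D0; case: ifP => // _; case: (kap _) => //= a.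
  rewrite inE; case: ifP => //= _ /eqP [<-]; by rewrite inordK.
(* If instead all capacities are met, [#|ZS :\: ZO|] points are assigned; since only points of
   [ZO :\: ZS] can be and there are no more of them, each is assigned. *)
have D4 : {in ZO :\: ZS, forall x, D x != None}.
  case: D3 => [D3 x xZ|D3].
    case: (boolP (x \in [set x in ZO :\: ZS | D0 x == None])) => [/D3 //|xF].
    by rewrite D1 //; move: xF; rewrite inE xZ.
  have sub : [set x | D x != None] \subset ZO :\: ZS.
    apply/subsetP=> x; rewrite inE; apply: contraR => xZ.
    have e : D0 x = None by rewrite /D0 (negbTE xZ).
    by rewrite D1 ?e // inE negb_and xZ.
  have /eqP eD : [set x | D x != None] == ZO :\: ZS.
    rewrite eqEcard sub /= (leq_trans cD) // -sum_card_some.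
    under eq_bigr do rewrite D3 -omoE.
    by rewrite (sum_card_fibre omo) cardsE; apply: subset_leq_card;
      apply/subsetP=> x;
      rewrite !inE andbT.
  by move=> x; rewrite -eD inE.
pose tau i : 'I_N.+1 := inord (chi (g i)).
exists N.+1, P, Q, tau, omo, (fun x => odflt ord0 (D x)).
have cG (t : 'I_N.+1) : #|[set i | chi (g i) == t]|
    = \sum_(a in Gt t) #|[set i | g i == a]|.
  have := sum_card_fibre g setT (mem (Gt t)).
  rewrite (_ : [set x in setT | _] = [set i | chi (g i) == t]); last first.
    by apply/setP=> i; rewrite !inE.
  by move <-; apply: eq_bigr => a _; apply: eq_card => i; rewrite !inE.
have cQ (t : 'I_N.+1) : #|Q t| = \sum_(a in Gt t :\: U) #|[set i | g i == a]|.+1.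
  under eq_bigr do rewrite -kapc.
  rewrite -sum1_card (partition_big (fun j => odflt ord0 (kap j)) (mem (Gt t :\: U))) /=.
    apply: eq_bigr => a; rewrite !inE => aP; rewrite -[RHS]sum1_card.
    apply: eq_bigl => j; rewrite !inE; case: (kap j) => //= a'.
    case: (eqVneq a' a) => [->|]; first by rewrite aP eqxx.
    by rewrite andbF => /negbTE ne; apply/esym/negbTE;
      apply: contraFN ne => /eqP [->].
  by move=> j; rewrite !inE; case: (kap j).
split; split.
- by move: Nw; rewrite cardsT card_ord.
- move=> t; have [/andP [H1 _] H2 _ [c H4]] := H t.
  apply: leq_trans (subset_leq_card H4) _.
  apply: leq_trans (leq_card_setU _ _) _.
  (* Each of the at least [w] groups brings one extra slot; the group in [U] costs at most [h.+1]
     slots and the foreign group adds at most [h] centres, so [h.*2 < w] is exactly enough. *)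
  have : \sum_(a in Gt t) #|[set i | g i == a]|.+1
      <= #|Q t| + h.+1.
    rewrite (big_setID U) /= -cQ addnC leq_add2l.
    apply: leq_trans (_ : \sum_(a in Gt t :&: U) h.+1 <= _).
      by apply: leq_sum => a _; rewrite ltnS.
    rewrite sum_nat_const -[leqRHS]mul1n leq_mul2r; apply/orP; right.
    apply: leq_trans H2; apply: subset_leq_card; apply/subsetP=> a.
    by rewrite !inE andbC.
  rewrite (eq_bigr (fun a => #|[set i | g i == a]| + 1)); last by move=> a _;
    rewrite addn1.
  rewrite big_split /= sum1_card -cG.
  have arith a b d e : w <= a -> e <= h -> b + a <= d + h.+1 -> b + e <= d.
    by move: hw; rewrite -addnn; lia.
  exact: arith H1 (gh c).
- move=> t; have [/andP [_ H1] _ _ _] := H t; rewrite cQ.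
  apply: leq_trans (_ : \sum_(a in Gt t :\: U) h.+1 <= _).
    by apply: leq_sum => a _; rewrite ltnS.
  rewrite sum_nat_const leq_mul2r; apply/orP; right.
  by apply: leq_trans (ltnW H1); apply: subset_leq_card; exact: subsetDl.
- move=> t; rewrite omoE; apply: leq_trans (D2 t); apply: subset_leq_card.
  apply/subsetP=> x; rewrite inE [in X in _ -> X]inE => /andP [/D4].
  by case: (D x) => //= a _ /eqP ->.
- by move=> i; rewrite !inE inordK ?eqxx.
- move=> j t t'; rewrite !inE;
  case: (kap j) => // a /andP [_ /eqP e] /andP [_ /eqP e'].
  by apply: val_inj; rewrite /= -e -e'.
- move=> i t; rewrite inE; case e: (kap _) => [a|//] /andP [_ at'].
  by rewrite !inE (kapP _ _ e) at'.
- move=> x xZ; rewrite in_setU; apply/orP; right; apply: imset_f.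
  by rewrite inE xZ inordK ?omN ?eqxx.
- move=> x xZ t; rewrite inE; case e: (kap _) => [a|//] /andP [aU /eqP at'].
  have D0x : D0 x = Some t.
    by rewrite /D0 xZ e (negbTE aU); congr Some; apply: val_inj;
      rewrite /= inordK.
  by rewrite D1 ?D0x //= inE D0x andbF.
Qed.

(** * Costs *)

From mathcomp Require Import boolp classical_sets reals topology normedtype.

Import Order.TTheory GRing.Theory Num.Theory numFieldNormedType.Exports.

Local Open Scope fset_scope.
Local Open Scope ring_scope.

Lemma card_fset_image (J : finType) (K : choiceType) (f : J -> K) (Q : {set J}) :
  (#|` [fset f j | j in Q]| <= #|Q|)%N.
Proof.
rewrite cardE -(size_map f); apply: uniq_leq_size; first exact: fset_uniq.
move=> c /imfsetP [j jQ ->]; apply: map_f; by rewrite mem_enum.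
Qed.

Lemma min_ofP (R : realType) (s : seq R) : s != [::] ->
  min_of s \in s /\ {in s, forall a, min_of s <= a}.
Proof.
have H (x : R) (l : seq R) : \big[Num.min/x]_(a <- l) a \in x :: l /\
    {in x :: l, forall a, \big[Num.min/x]_(b <- l) b <= a}.
  elim: l => [|b l [IH1 IH2]].
    by rewrite big_nil inE; split=> // a; rewrite inE => /eqP ->.
  rewrite big_cons; split.
    rewrite /Num.min; case: ifP => _; first by rewrite !inE eqxx orbT.
    by move: IH1; rewrite !inE => /orP [->|->]; rewrite ?orbT.
  move=> a; rewrite ge_min !inE => /or3P [/eqP -> |/eqP ->|al].
  - by rewrite IH2 ?orbT // inE eqxx.
  - by rewrite lexx.
  - by rewrite IH2 ?orbT // inE al orbT.
case: s => // x s _; rewrite /min_of /=; have [H1 H2] := H x (x :: s); split.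
  by move: H1; rewrite !inE orbA orbb.
by move=> a as_; apply: H2; rewrite inE as_ orbT.
Qed.

Section Distances.
Variables (R : realType) (T : metricType R).
Implicit Types (x c : T) (S X Z : {fset T}).

Lemma dist_to_le x c S : c \in S -> dist_to x S <= mdist x c.
Proof.
move=> cS; have ne : [seq mdist x c0 | c0 <- S] != [::].
  by apply/eqP=> e; have := map_f (mdist x) cS; rewrite e.
by have [_] := min_ofP ne; apply; apply: map_f.
Qed.

Lemma dist_to_attained x S : S != fset0 ->
  exists2 c, c \in S & dist_to x S = mdist x c.
Proof.
case/fset0Pn=> c cS; have ne : [seq mdist x c0 | c0 <- S] != [::].
  by apply/eqP=> e; have := map_f (mdist x) cS; rewrite e.
by have [/mapP [c' c'S e] _] := min_ofP ne; exists c'.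
Qed.

Lemma dist_to_ge0 x S : S != fset0 -> 0 <= dist_to x S.
Proof. by case/(dist_to_attained x)=> c _ ->; exact: mdist_ge0. Qed.

Lemma dist_to_sub x S S' : S != fset0 -> S `<=` S' ->
  dist_to x S' <= dist_to x S.
Proof.
by case/(dist_to_attained x)=> c cS -> /fsubsetP /(_ _ cS); exact: dist_to_le.
Qed.

Lemma sum_outside X (V : {set X}) (F : T -> R) :
  \sum_(x <- X `\` [fset val y | y in V]) F x
  = \sum_(x : X | x \notin V) F (val x).
Proof.
set Z := [fset _ | _ in _].
have /(perm_big _) -> : perm_eq (X `\` Z) [seq x <- X | x \notin Z].
  apply: uniq_perm; rewrite ?filter_uniq ?fset_uniq // => x.
  by rewrite mem_filter in_fsetD.
rewrite big_filter big_seq_fsetE /=; apply: eq_bigl => x; congr (~~ _).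
by apply/imfsetP/idP => [[y yV /val_inj ->]|xV] //; exists x.
Qed.

Lemma fset_of_setP X Z : Z `<=` X ->
  exists2 V : {set X}, Z = [fset val y | y in V] & #|V| = #|` Z|.
Proof.
move=> ZX; pose V := [set y : X | val y \in Z]; exists V.
  apply/fsetP=> x; apply/idP/imfsetP => [xZ|[y yV ->]]; last by move: yV;
    rewrite /= inE.
  by exists [` fsubsetP ZX _ xZ] => //=; rewrite inE.
rewrite cardE -(size_map val); apply: perm_size; apply: uniq_perm.
- by rewrite map_inj_uniq ?enum_uniq //; exact: val_inj.
- exact: fset_uniq.
move=> x; apply/mapP/idP => [[y]|xZ]; first by rewrite mem_enum inE => ? ->.
by exists [` fsubsetP ZX _ xZ] => //=; rewrite mem_enum inE.
Qed.

(** Discarded points are taken in the finite type of points of [X], where the combinatorial lemmas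
    apply. *)
Definition outlier_sum (p : nat) X S (V : {set X}) : R :=
  \sum_(x : X | x \notin V) dist_to (val x) S ^+ p.

Lemma out_costP p X z S :
  let s := [seq \sum_(x <- X `\` Z) dist_to x S ^+ p
         | Z <- fpowerset X & (#|` Z| <= z)%N] in
  out_cost p X z S \in s /\ {in s, forall a, out_cost p X z S <= a}.
Proof.
apply: min_ofP; apply/eqP => e.
have : (fset0 : {fset T}) \in [seq Z : {fset T} <- fpowerset X | (#|` Z| <= z)%N].
  by rewrite mem_filter cardfs0 fpowersetE fsub0set.
by move/(map_f (fun Z => \sum_(x <- X `\` Z) dist_to x S ^+ p)); rewrite e.
Qed.

Lemma out_cost_le p X z S (V : {set X}) : (#|V| <= z)%N ->
  out_cost p X z S <= outlier_sum p S V.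
Proof.
move=> Vz; have [_ H] := out_costP p X z S; rewrite /outlier_sum.
rewrite -(sum_outside V (fun x => dist_to x S ^+ p)); apply: H.
apply/mapP; exists [fset val y | y in V] => //.
rewrite mem_filter fpowersetE (leq_trans (card_fset_image val V) Vz) /=.
by apply/fsubsetP=> x /imfsetP [y _ ->]; exact: valP.
Qed.

(** Discarding further points does not raise the cost, so an optimal outlier set can be padded to
    the maximal size. This makes the outlier sets of S and O equally large. *)
Lemma out_cost_attained p X z S : S != fset0 ->
  exists2 V : {set X}, #|V| = minn z #|{: X}|
                     & out_cost p X z S = outlier_sum p S V.
Proof.
move=> S0; have [/mapP [Z]] := out_costP p X z S.
rewrite mem_filter fpowersetE => /andP [Zz ZX] e _.
have [V eZ cV] := fset_of_setP ZX.
rewrite eZ sum_outside -/(outlier_sum p S V) in e.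
have Vz : (#|V| <= minn z #|{: X}|)%N by rewrite leq_min cV Zz -cV max_card.
have [V2 V2s V2c] : exists2 V2 : {set X}, V2 \subset ~: V
    & #|V2| = (minn z #|{: X}| - #|V|)%N.
  by apply: subset_of_card;
    rewrite [#|~: V|]cardsCs finset.setCK leq_sub2r // geq_minr.
have cV' : #|V :|: V2| = minn z #|{: X}|.
  rewrite cardsU V2c (_ : V :&: V2 = finset.set0) ?finset.cards0 ?subn0 ?subnKC //.
  by apply/eqP; rewrite finset.setI_eq0 disjoint_sym finset.disjoints_subset.
exists (V :|: V2) => //; apply/eqP; rewrite eq_le; apply/andP; split.
  by apply: out_cost_le; rewrite cV' geq_minl.
rewrite e /outlier_sum big_mkcond [leRHS]big_mkcond; apply: ler_sum => x _.
by rewrite inE negb_or; case: (x \in V); case: (x \in V2) => //=;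
  rewrite exprn_ge0 ?dist_to_ge0.
Qed.
End Distances.

(** * Adding up the test swaps *)

(** The inequality holds point by point. [A x] and [B x] stand for the costs of x in O and in S,
    [M x] for the cost of the detour through its optimal centre, and [F t x] for its cost after swap
    [t]. The four cases say which of S and O discard x. *)
Lemma reassignment_sum (R : realType) (X I J : finType) (o : X -> I)
    (s : X -> J) (ZS ZO : {set X}) (N : nat) (P : 'I_N -> {set I})
    (Q : 'I_N -> {set J}) (tau : I -> 'I_N) (om D : X -> 'I_N)
    (Z : 'I_N -> {set X}) (A B M : X -> R) (F : 'I_N -> X -> R) :
  (forall i, i \in P (tau i)) ->
  (forall j t t', j \in Q t -> j \in Q t' -> t = t') ->
  {in ZS :\: ZO, forall x, o x \in P (om x)} ->
  {in ZO :\: ZS, forall x t, s x \in Q t -> D x = t} ->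
  (forall t, Z t = (ZS :\: [set x in ZS :\: ZO | om x == t])
                     :|: [set x in ZO :\: ZS | D x == t]) ->
  (forall x, B x <= M x) ->
  (forall t x, o x \in P t -> F t x <= A x) ->
  (forall t x, s x \notin Q t -> F t x <= B x) ->
  (forall t x, F t x <= M x) ->
  \sum_t \sum_(x | x \notin Z t) F t x
    <= N%:R * (\sum_(x | x \notin ZS) B x)
       + (\sum_(x | x \notin ZO) A x - \sum_(x | x \notin ZS) B x)
       + \sum_(x | x \notin ZS :|: ZO) (M x - B x).
Proof.
move=> Ptau Qdisj omP DQ ZE BM FA FB FM.
have memZ t x : (x \in Z t) = (x \in ZS) && ~~ ((x \notin ZO) && (om x == t))
    || [&& x \notin ZS, x \in ZO & D x == t].
  rewrite ZE !inE; case: (x \in ZS); case: (x \in ZO) => //=.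
  by rewrite andbT.
under eq_bigr do rewrite big_mkcond.
rewrite exchange_big /= [\sum_(x | x \notin ZS) B x]big_mkcond.
rewrite [\sum_(x | x \notin ZO) A x]big_mkcond.
rewrite [X in _ <= _ + X]big_mkcond /= mulr_sumr -sumrB -!big_split /=.
apply: ler_sum => x _; under eq_bigr do rewrite memZ.
rewrite finset.in_setU.
case: (boolP (x \in ZS)) => xS; case: (boolP (x \in ZO)) => xO /=.
- by rewrite big1 //; lra.
- have -> : \sum_(t < N) (if ~~ (~~ (om x == t) || false) then F t x else 0)
      = F (om x) x.
    rewrite (bigD1 (om x)) //= eqxx /= big1 ?addr0 // => t.
    by rewrite eq_sym => /negbTE ->.
  have : F (om x) x <= A x by apply: FA; apply: omP; rewrite inE xO.
  lra.
- rewrite (bigD1 (D x)) //= eqxx /= add0r.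
  have : \sum_(t < N | t != D x) (if D x != t then F t x else 0)
      <= \sum_(t < N | t != D x) B x.
    apply: ler_sum => t; rewrite eq_sym => ne; rewrite ne; apply: FB.
    by apply: contra ne => sQ; apply/eqP; apply: DQ sQ; rewrite inE xS.
  rewrite sumr_const cardC1 card_ord -mulr_natl.
  have -> : N%:R = N.-1%:R + 1 :> R.
    by rewrite natr1 prednK //; apply: leq_trans (ltn_ord (D x)).
  lra.
(* A common inlier pays [B x] in every swap, except for the gain in swap [tau (o x)] and the loss in
   the at most one swap that closes its slot. *)
have : \sum_(t < N) F t x <= \sum_(t < N) (B x
    + (if t == tau (o x) then A x - B x else 0)
    + (if s x \in Q t then M x - B x else 0)).
  apply: ler_sum => t _; have BMx := BM x.
  case: eqP => [->|_].
    by have := FA _ _ (Ptau (o x)); case: ifP => _; lra.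
  case: (boolP (s x \in Q t)) => sQ; first by have := FM t x; lra.
  by have := FB _ _ sQ; lra.
rewrite !big_split /= sumr_const card_ord mulr_natl -[X in _ + X + _]big_mkcond.
rewrite big_pred1_eq -big_mkcond /=.
have : \sum_(t < N | s x \in Q t) (M x - B x) <= M x - B x.
  case: (pickP (fun t => s x \in Q t)) => [t tQ|none].
    rewrite (big_pred1 t) // => t' /=; apply/idP/eqP => [|-> //].
    by move=> t'Q; apply: Qdisj t'Q tQ.
  by rewrite big_pred0 // subr_ge0.
lra.
Qed.

Section Estimate.
Variables (R : realType) (T : metricType R).
Implicit Types (S O C : {fset T}).

(** Common consequence of the stopping rules of both variants, with relative slack [eta]. *)
Definition swap_optimal (cost : {fset T} -> R) (eta : R) (rho : nat) C
    (K : nat) S :=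
  forall S', S' != fset0 -> S' `<=` C -> (#|` S' `\` S| <= rho)%N ->
    (#|` S `\` S'| <= rho)%N -> (#|` S'| <= K)%N ->
    (1 - eta) * cost S <= cost S'.

(* S is enumerated with repetitions: when |S| < K the extra copies stand for
   unused budget, and c is closed only if all its copies are. *)
Lemma slot_enumeration S (K : nat) : S != fset0 -> (#|` S| <= K)%N ->
  exists loc : 'I_K -> T,
    (forall j, loc j \in S) /\ (forall c, c \in S -> exists j, loc j = c).
Proof.
case/fset0Pn=> c0 c0S SK; exists (fun j : 'I_K => nth c0 S j); split=> [j|c cS].
  case: (ltnP j #|` S|) => jS; first by rewrite mem_nth.
  by rewrite nth_default.
have lt : (index c S < K)%N by apply: leq_trans SK; rewrite index_mem.
by exists (Ordinal lt) => /=; rewrite nth_index.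
Qed.

(** Passing from slots to centres can only shrink the sets counted, so [#|P| <= #|Q|] and
    [#|Q| <= rho] give all size constraints. *)
Lemma slot_swap (cost : {fset T} -> R) (eta : R) (rho K k : nat) C S
    (loc : 'I_K -> T) (oloc : 'I_k -> T) (P : {set 'I_k}) (Q : {set 'I_K}) :
  swap_optimal cost eta rho C K S -> S `<=` C ->
  (forall j, loc j \in S) -> (forall c, c \in S -> exists j, loc j = c) ->
  (forall i, oloc i \in C) ->
  (#|P| <= #|Q|)%N -> (#|Q| <= rho)%N ->
  let S' := [fset loc j | j in ~: Q] `|` [fset oloc i | i in P] in
  S' != fset0 -> (1 - eta) * cost S <= cost S'.
Proof.
move=> opt SC locS locK olocC PQ Qr S' S'0; apply: opt => //.
- apply/fsubsetP=> c; rewrite inE => /orP [] /imfsetP [i _ ->] //.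
  exact: fsubsetP SC _ (locS _).
- apply: leq_trans Qr; apply: leq_trans PQ;
  apply: leq_trans (card_fset_image oloc P).
  apply: fsubset_leq_card; apply/fsubsetP=> c;
    rewrite !inE => /andP [cS /orP []] //.
  by case/imfsetP=> j _ e; rewrite e locS in cS.
- apply: leq_trans Qr; apply: leq_trans (card_fset_image loc Q).
  apply: fsubset_leq_card; apply/fsubsetP=> c; rewrite !inE negb_or.
  case/andP=> /andP [cQ _] /locK [j e]; apply/imfsetP; exists j => //=.
  by apply: contraNT cQ => jQ; apply/imfsetP; exists j; rewrite //= inE.
- apply: leq_trans (_ : (#|~: Q| + #|P| <= K)%N).
    rewrite cardfsU; apply: leq_trans (leq_subr _ _) _.
    by apply: leq_add; apply: card_fset_image.
  have := cardsC Q; rewrite card_ord; lia.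
Qed.

Lemma out_cost_ge0 p (X : {fset T}) z S : S != fset0 -> 0 <= out_cost p X z S.
Proof.
move=> S0; have [V _ ->] := out_cost_attained p X z S0.
by apply: sumr_ge0 => x _; rewrite exprn_ge0 ?dist_to_ge0.
Qed.

Lemma out_cost_sub p (X : {fset T}) z S S' : S != fset0 -> S `<=` S' ->
  out_cost p X z S' <= out_cost p X z S.
Proof.
move=> S0 SS'; have [V cV ->] := out_cost_attained p X z S0.
have S'0 : S' != fset0.
  by have /fset0Pn [c /(fsubsetP SS') ?] := S0; apply/fset0Pn; exists c.
apply: le_trans (out_cost_le p S' (V := V) _) _; first by rewrite cV geq_minl.
apply: ler_sum => x _; apply: lerXn2r; rewrite ?nnegrE ?dist_to_ge0 //.
exact: dist_to_sub.
Qed.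

(** For small k a single swap opens all of O. *)
Lemma local_opt_small p (X : {fset T}) z eta rho C K k S O :
  swap_optimal (out_cost p X z) eta rho C K S ->
  S `<=` C -> S != fset0 -> (#|` S| <= K)%N ->
  O `<=` C -> O != fset0 -> (#|` O| <= k)%N -> (k <= K)%N -> (k <= rho)%N ->
  (1 - eta) * out_cost p X z S <= out_cost p X z O.
Proof.
move=> opt SC S0 SK OC O0 Ok kK kr.
have [loc [locS locK]] := slot_enumeration S0 SK.
have [oloc [olocO olocK]] := slot_enumeration O0 Ok.
have [Q _ cQ] : exists2 Q : {set 'I_K}, Q \subset [set: 'I_K]%SET & #|Q| = k.
  by apply: subset_of_card; rewrite cardsT card_ord.
have OS' : O `<=` [fset loc j | j in ~: Q] `|` [fset oloc i | i in [set: 'I_k]%SET].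
  apply/fsubsetP=> c /olocK [i <-]; rewrite inE; apply/orP; right.
  by apply/imfsetP; exists i; rewrite //= inE.
apply: le_trans (out_cost_sub p X z O0 OS');
  apply: slot_swap opt _ _ _ _ _ _ _ => //.
- by move=> i; apply: (fsubsetP OC).
- by rewrite cQ cardsT card_ord.
- by rewrite cQ.
- have /fset0Pn [c /(fsubsetP OS') ?] := O0; apply/fset0Pn; by exists c.
Qed.

(** [alpha] and [beta] split the detour term between the costs of O and S; [N%:R * eta] is the slack
    accumulated over the N swaps. *)
Lemma local_opt_bound p (alpha beta : R) (X : {fset T}) z eta rho C K k h w S O :
  (forall a b : R, 0 <= a -> 0 <= b ->
     (2 * a + b) ^+ p - b ^+ p <= alpha * a ^+ p + beta * b ^+ p) ->
  0 <= alpha -> 0 <= beta ->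
  let n := (k %/ h).+1 in
  (0 < h)%N -> (k + n.*2 <= K)%N -> (h.*2 < w)%N -> (w <= n)%N ->
  (w.*2 * h.+1 <= rho)%N -> (rho < K)%N ->
  swap_optimal (out_cost p X z) eta rho C K S ->
  S `<=` C -> S != fset0 -> (#|` S| <= K)%N ->
  O `<=` C -> O != fset0 -> (#|` O| <= k)%N ->
  exists2 N : nat, (N * w <= n)%N
    & (1 - beta - N%:R * eta) * out_cost p X z S
        <= (1 + alpha) * out_cost p X z O.
Proof.
move=> pw al0 be0 n h0 nK hw wn wr rK opt SC S0 SK OC O0 Ok.
have [loc [locS locK]] := slot_enumeration S0 SK.
have [oloc [olocO olocK]] := slot_enumeration O0 Ok.
have [ZS cZS eS] := out_cost_attained p X z S0.
have [ZO cZO eO] := out_cost_attained p X z O0.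
pose dS (x : X) := dist_to (val x) S; pose dO (x : X) := dist_to (val x) O.
have dS0 x : 0 <= dS x by apply: dist_to_ge0.
have dO0 x : 0 <= dO x by apply: dist_to_ge0.
have [s sP] : exists s : X -> 'I_K, forall x, mdist (val x) (loc (s x)) = dS x.
  apply: (@fin_all_exists X (fun=> 'I_K)
    (fun x j => mdist (val x) (loc j) = dS x)) => x.
  have [c /locK [j <-] e] := dist_to_attained (val x) S0.
  by exists j.
have [o oP] : exists o : X -> 'I_k, forall x, mdist (val x) (oloc (o x)) = dO x.
  apply: (@fin_all_exists X (fun=> 'I_k)
    (fun x i => mdist (val x) (oloc i) = dO x)) => x.
  have [c /olocK [j <-] e] := dist_to_attained (val x) O0.
  by exists j.
have [phi phiP] : exists phi : 'I_k -> 'I_K,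
    forall i, mdist (oloc i) (loc (phi i)) = dist_to (oloc i) S.
  apply: (@fin_all_exists _ (fun=> 'I_K)
    (fun i j => mdist (oloc i) (loc j) = dist_to (oloc i) S)) => i.
  have [c /locK [j <-] e] := dist_to_attained (oloc i) S0.
  by exists j.
have [||//|//|N [P [Q [tau [om [D [[Nw PQ Qr Dom] [Ptau Qdisj phiQ omP DQ]]]]]]]] :=
  @swap_family X 'I_k 'I_K o s phi ZS ZO h w h0.
- by rewrite cZS cZO.
- by rewrite !card_ord.
- by rewrite card_ord.
rewrite card_ord in Nw; exists N => //.
pose S' t := [fset loc j | j in ~: Q t] `|` [fset oloc i | i in P t].
(* By [rho < K] some slot stays open. *)
have S'0 t : S' t != fset0.
  have : (0 < #|~: Q t|)%N.
    have := cardsC (Q t); rewrite card_ord; have := Qr t; lia.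
  case/card_gt0P=> j jQ; apply/fset0Pn; exists (loc j); rewrite inE.
  by apply/orP; left; apply/imfsetP; exists j.
have locS' t j : j \notin Q t -> loc j \in S' t.
  move=> jQ; rewrite inE; apply/orP; left; apply/imfsetP; exists j => //=.
  by rewrite inE.
have olocS' t i : i \in P t -> oloc i \in S' t.
  by move=> iP; rewrite inE; apply/orP; right; apply/imfsetP; exists i.
pose Z t := (ZS :\: [set x in ZS :\: ZO | om x == t]%SET)
                     :|: [set x in ZO :\: ZS | D x == t]%SET.
pose F t (x : X) := dist_to (val x) (S' t) ^+ p.
have pow a b : 0 <= a -> a <= b -> a ^+ p <= b ^+ p.
  by move=> a0 ab; apply: lerXn2r; rewrite ?nnegrE // (le_trans a0).
have d'0 t x : 0 <= dist_to x (S' t) by apply: dist_to_ge0.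
have FA t x : o x \in P t -> F t x <= dO x ^+ p.
  by move=> oxP; apply: pow => //; rewrite -oP; apply/dist_to_le/olocS'.
have FB t x : s x \notin Q t -> F t x <= dS x ^+ p.
  by move=> sxQ; apply: pow => //; rewrite -sP; apply/dist_to_le/locS'.
have FM t x : F t x <= (2 * dO x + dS x) ^+ p.
  (* Either [o x] is open after the swap, or x goes through [o x] to the slot nearest to it, at
     distance at most dO + (dO + dS). *)
  apply: pow => //; case: (boolP (phi (o x) \in Q t)) => [/phiQ oxP|nQ].
    apply: le_trans (dist_to_le (val x) (olocS' _ _ oxP)) _; rewrite oP.
    by have := dO0 x; have := dS0 x; lra.
  apply: le_trans (dist_to_le (val x) (locS' _ _ nQ)) _.
  apply: le_trans (metric_triangle (val x) (oloc (o x)) _) _.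
  have : dist_to (oloc (o x)) S <= mdist (oloc (o x)) (loc (s x)) by apply: dist_to_le.
  have := metric_triangle (oloc (o x)) (val x) (loc (s x)).
  rewrite (metric_sym (oloc (o x)) (val x)) oP phiP sP; lra.
have BM x : dS x ^+ p <= (2 * dO x + dS x) ^+ p.
  by apply: pow => //; have := dO0 x; lra.
have := reassignment_sum Ptau Qdisj omP DQ (fun t => erefl (Z t)) BM FA FB FM.
rewrite -/(outlier_sum p S ZS) -/(outlier_sum p O ZO) -eS -eO => up.
have lo t : (1 - eta) * out_cost p X z S <= \sum_(x | x \notin Z t) F t x.
  have cZ : (#|Z t| <= z)%N.
    apply: leq_trans (finset.leq_card_setU _ _) _; rewrite finset.cardsD.
    rewrite (finset.setIidPr _); last first.
      by apply/fintype.subsetP=> x; rewrite !inE => /andP [/andP [_ ->]].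
    have := Dom t; have : (#|ZS| <= z)%N by rewrite cZS geq_minl.
    have : (#|[set x in ZS :\: ZO | om x == t]%SET| <= #|ZS|)%N.
      by apply: subset_leq_card; apply/fintype.subsetP=> x;
        rewrite !inE => /andP [/andP [_ ->]].
    lia.
  apply: le_trans (out_cost_le p (S' t) cZ).
  apply: slot_swap opt _ _ _ _ _ _ _ => //.
  - by move=> i; apply: (fsubsetP OC).
  - exact: leq_trans wr.
  - exact: S'0.
have {}lo : N%:R * ((1 - eta) * out_cost p X z S)
    <= \sum_t \sum_(x | x \notin Z t) F t x.
  apply: le_trans (_ : \sum_(t < N) (1 - eta) * out_cost p X z S <= _).
    by rewrite sumr_const card_ord mulr_natl.
  by apply: ler_sum.
have mid : \sum_(x | x \notin ZS :|: ZO) ((2 * dO x + dS x) ^+ p - dS x ^+ p)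
    <= alpha * out_cost p X z O + beta * out_cost p X z S.
  apply: le_trans (_ : \sum_(x | x \notin ZS :|: ZO) (alpha * dO x ^+ p + beta * dS x ^+ p) <= _).
    by apply: ler_sum => x _; apply: pw.
  rewrite big_split /= -!mulr_sumr eS eO /outlier_sum.
  apply: lerD; apply: ler_wpM2l => //; rewrite big_mkcond [leRHS]big_mkcond;
    apply: ler_sum => x _; rewrite finset.in_setU negb_or;
    case: (x \in ZS); case: (x \in ZO) => //=;
      by rewrite exprn_ge0 ?dist_to_ge0.
lra.
Qed.
End Estimate.

(** * Local search *)

Local Open Scope classical_set_scope.
Local Open Scope fset_scope.
Local Open Scope ring_scope.

Section LocalSearch.
Variables (R : realType) (T : metricType R).
Implicit Types (S O C : {fset T}) (v : variant) (cost : {fset T} -> R).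

Lemma improves_lt v (eps : R) m new old : improves v eps m new old -> new < old.
Proof. by case: v => // -[]. Qed.

Lemma swap_step_sub v cost eps rho C k S S' :
  swap_step v cost eps rho C k S S' -> S `<=` C -> S' `<=` C.
Proof.
case=> P [Q [[PC _ _ _] [-> _ _ _]]] SC; rewrite fsubUset; apply/andP; split.
  exact: fsubset_trans (fsubsetDl _ _) SC.
exact: fsubset_trans PC (fsubsetDl _ _).
Qed.

Lemma swap_step_lt v cost eps rho C k S S' :
  swap_step v cost eps rho C k S S' -> cost S' < cost S.
Proof. by case=> P [Q [_ [_ _ _ /improves_lt]]]. Qed.

(** Costs strictly decrease, so an infinite run would visit infinitely many distinct subsets of
    [C]. *)
Lemma swap_terminates v cost (eps : R) rho C k : terminates v cost eps rho C k.
Proof.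
case=> run [[run0C _] step].
have runC i : run i `<=` C.
  by elim: i => // i; apply: swap_step_sub (step i).
have dec i d : cost (run (i + d.+1)%N) < cost (run i).
  elim: d => [|d IH]; first by rewrite addn1; apply: swap_step_lt (step i).
  by apply: lt_trans IH; rewrite addnS; apply: swap_step_lt (step _).
have inj : injective run.
  move=> i j e; case: (ltngtP i j) => // lt.
    by have := dec i (j - i).-1;
      rewrite prednK ?subn_gt0 // subnKC ?(ltnW lt) // e ltxx.
  by have := dec j (i - j).-1;
    rewrite prednK ?subn_gt0 // subnKC ?(ltnW lt) // e ltxx.
have := @uniq_leq_size _ [seq run i | i <- iota 0 #|` fpowerset C|.+1] (fpowerset C).
rewrite map_inj_uniq ?iota_uniq // size_map size_iota ltnn => H.
by apply: notF; apply: H => // A /mapP [i _ ->]; rewrite fpowersetE.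
Qed.

Definition budget (eps : R) (k : nat) : nat := Num.truncn ((1 + eps) * k%:R).

Lemma within_budgetE (eps : R) k S : 0 < eps ->
  within_budget eps k S <-> (#|` S| <= budget eps k)%N.
Proof.
move=> e0; rewrite /within_budget /budget truncn_ge_nat //.
by rewrite mulr_ge0 // addr_ge0 // ltW.
Qed.

(** The last clause covers a budget that admits all of [C]: the search then starts at [C] itself and
    never gets worse. *)
Lemma returned_inv v cost (eps : R) rho C k S : 0 < eps -> C != fset0 ->
  (0 < k)%N -> returned v cost eps rho C k S ->
  [/\ S `<=` C, S != fset0, (#|` S| <= budget eps k)%N
    & (#|` C| <= budget eps k)%N -> cost S <= cost C].
Proof.
move=> e0 C0 k0 [S0 [[S0C cS0] steps _]].
have kb : (k <= budget eps k)%N.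
  by rewrite /budget truncn_ge_nat ?ler_peMl ?lerDl ?mulr_ge0 ?addr_ge0 // ltW.
have base : [/\ S0 `<=` C, S0 != fset0, (#|` S0| <= budget eps k)%N
    & (#|` C| <= budget eps k)%N -> cost S0 <= cost C].
  split=> //.
  - by rewrite -cardfs_gt0 cS0 leq_min (leq_trans k0 kb) cardfs_gt0.
  - by rewrite cS0 geq_minl.
  move=> Cb; suff -> : S0 = C by [].
  by apply/eqP; rewrite eqEfcard S0C cS0 leq_min Cb leqnn.
elim: steps base => // {cS0 S0C S0}.
- move=> S0 S1 st [SC _ _ le]; split; first exact: swap_step_sub st SC.
  + by case: st => P [Q [_ []]].
  + by case: st => P [Q [_ [_ _ /within_budgetE -/(_ e0)]]].
  by move/le; apply: le_trans; apply: ltW; apply: swap_step_lt st.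
- by move=> S0 S1 S2 _ IH1 _ IH2 /IH1.
Qed.

Lemma returned_swap_optimal v cost (eps : R) rho C k S :
  0 < eps -> S `<=` C -> 0 <= cost S -> returned v cost eps rho C k S ->
  swap_optimal cost (eps / #|` C|%:R) rho C (budget eps k) S.
Proof.
move=> e0 SC cS [_ [_ _ stuck]] S' S'0 S'C cP cQ cS'.
rewrite leNgt; apply/negP => lt; apply: stuck;
  exists S', (S' `\` S), (S `\` S').
have mu0 : 0 <= eps / #|` C|%:R by rewrite divr_ge0 // ltW.
have lt' : cost S' < cost S.
  apply: lt_le_trans lt _; rewrite -[leRHS]mul1r ler_wpM2r //; lra.
split; split=> //.
- exact: fsetSD.
- exact: fsubsetDl.
- apply/fsetP=> c; rewrite !inE; case: (c \in S); case: (c \in S') => //.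
- exact/within_budgetE.
- by case: v => //=; split=> //; exact: ltW.
Qed.

Lemma OPT_attained cost C k : C != fset0 -> (0 < k)%N ->
  exists O, [/\ O `<=` C, O != fset0, (#|` O| <= k)%N & OPT cost C k = cost O].
Proof.
move=> C0 k0.
pose l : seq R := [seq cost A | A <- fpowerset C & (A != fset0) && (#|` A| <= k)%N].
have l0 : l != [::].
  have /fset0Pn [c cC] := C0; apply/eqP => e.
  have : [fset c] \in [seq A : {fset T} <- fpowerset C | (A != fset0) && (#|` A| <= k)%N].
    rewrite mem_filter fpowersetE fsub1set cC cardfs1 k0 !andbT.
    by apply/fset0Pn; exists c; rewrite inE.
  by move/(map_f cost); rewrite -/l e.
have [/mapP [O]] := min_ofP l0.
rewrite mem_filter fpowersetE => /andP [/andP [O0 Ok] OC] e _.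
by exists O.
Qed.

(* 42 is the smallest integer N with 25 <= N (1 - 2/5), as needed for p = 2. *)
Lemma ratio_arith (alpha beta gamma eps eta cS cO : R) (N k : nat) :
  0 < eps -> 0 <= alpha -> 1 <= gamma -> 1 + alpha = gamma * (1 - beta) ->
  gamma <= 42 * (1 - beta) -> 0 <= cS -> (N * 42 <= k)%N ->
  eta * ((1 + eps) * k%:R) <= eps -> 0 <= eta ->
  (1 - beta - N%:R * eta) * cS <= (1 + alpha) * cO ->
  cS <= (gamma + eps) * cO.
Proof.
move=> e0 al0 g1 ag gb cS0 Nk ek eta0 H.
have Nk' : N%:R * 42 <= k%:R :> R by rewrite -natrM ler_nat.
pose nu := N%:R * eta.
have nu0 : 0 <= nu by rewrite mulr_ge0.
have nuE : 42 * (nu * (1 + eps)) <= eps.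
  apply: le_trans ek; rewrite /nu.
  have -> : 42 * (N%:R * eta * (1 + eps)) = (eta * (1 + eps)) * (N%:R * 42) by ring.
  have -> : eta * ((1 + eps) * k%:R) = (eta * (1 + eps)) * k%:R by ring.
  by apply: ler_wpM2l => //; rewrite mulr_ge0 // addr_ge0 // ltW.
(* Equivalent to gamma (1 - beta) <= (gamma + eps) (1 - beta - nu). *)
have gnu : (gamma + eps) * nu <= eps * (1 - beta).
  have h1 : (gamma + eps) * nu <= gamma * (nu * (1 + eps)).
    have : 0 <= (gamma - 1) * (eps * nu) by rewrite !mulr_ge0 ?subr_ge0 // ltW.
    lra.
  have h2 : gamma * (nu * (1 + eps)) <= 42 * (1 - beta) * (nu * (1 + eps)).
    by apply: ler_wpM2r => //; rewrite mulr_ge0 // addr_ge0 // ltW.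
  have h3 : 0 <= (1 - beta) * (eps - 42 * (nu * (1 + eps))).
    by rewrite mulr_ge0 ?subr_ge0 //; nra.
  lra.
have a1 : 0 < 1 + alpha by lra.
rewrite -(ler_pM2l a1).
apply: le_trans (_ : (gamma + eps) * ((1 - beta - nu) * cS) <= _).
  rewrite mulrA ler_wpM2r //; nra.
have -> : (1 + alpha) * ((gamma + eps) * cO) = (gamma + eps) * ((1 + alpha) * cO) by ring.
by apply: ler_wpM2l => //; lra.
Qed.

(** * Choice of the parameters and the approximation ratio *)

(** With h > 4 / eps, the 2 k / h spare slots use at most half of eps k; the other half absorbs
    rounding. *)
Definition block_size (eps : R) : nat := (Num.truncn (4 / eps)).+1.

(** This is 2 w (h + 1) for w = 2 h + 43. The summand 43 gives both w > 2 h and, from N w <= k / h +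
    1, the bound 42 N <= k. *)
Definition swap_size (eps : R) : nat :=
  (((block_size eps).*2 + 43).*2 * (block_size eps).+1)%N.

Lemma swap_size_le (eps : R) : 0 < eps -> eps <= 1 / 100 ->
  (swap_size eps)%:R <= (1 / eps) ^+ 4.
Proof.
move=> e0 e1; set u := 1 / eps.
have u100 : 100 <= u by rewrite /u ler_pdivlMr //; lra.
have hu : (block_size eps)%:R <= 4 * u + 1.
  rewrite /block_size -natr1 lerD2r.
  have -> : 4 * u = 4 / eps by rewrite /u; field; lra.
  by rewrite truncn_le divr_ge0 // ltW.
rewrite /swap_size natrM -[_.+1%:R]natr1; move: (block_size eps) hu => h hu.
have -> : ((h.*2 + 43).*2)%:R = 4 * h%:R + 86 :> R.
  by rewrite -!addnn !natrD; ring.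
have h0 : 0 <= h%:R :> R by [].
(* From h <= 4 u + 1 and u >= 100: 4 h + 86 <= 17 u and h + 1 <= 5 u. *)
apply: le_trans (_ : (17 * u) * (5 * u) <= _).
  by apply: ler_pM; lra.
have -> : u ^+ 4 = (u * u) * (u * u) by ring.
have -> : 17 * u * (5 * u) = 85 * (u * u) by ring.
by apply: ler_wpM2r; nra.
Qed.

Lemma swap_size_slack (eps : R) (k : nat) : 0 < eps ->
  (swap_size eps < k)%N ->
  let h := block_size eps in
  (k + (k %/ h).+1.*2 <= budget eps k)%N /\ (h.*2 + 43 <= (k %/ h).+1)%N.
Proof.
move=> e0 kr h.
have h0 : (0 < h)%N by [].
have eh : 4 < eps * h%:R.
  have := truncnS_gt (4 / eps); rewrite -/(block_size eps) -/h.
  by rewrite ltr_pdivrMr // mulrC.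
have qk := leq_divM k h; set q := (k %/ h)%N in qk *.
have qk' : q%:R * h%:R <= k%:R :> R by rewrite -natrM ler_nat.
have hk : (84 * h <= k)%N.
  apply: leq_trans (ltnW kr); rewrite /swap_size -/h -addnn -addnn; nia.
have hk' : 84 * h%:R <= k%:R :> R by rewrite -natrM ler_nat.
split.
  rewrite /budget truncn_ge_nat; last by rewrite mulr_ge0 // addr_ge0 // ltW.
  rewrite -addnn -addn1 !natrD -/q.
  have q4 : 4 * q%:R <= eps * k%:R.
    apply: le_trans (_ : (eps * h%:R) * q%:R <= _);
      first by apply: ler_wpM2r => //; exact: ltW.
    by rewrite -mulrA ler_wpM2l ?(ltW e0) // [h%:R * _]mulrC.
  have k6 : 84 * 4 <= eps * k%:R.
    apply: le_trans (_ : eps * (84 * h%:R) <= _);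
      last by rewrite ler_wpM2l // ltW.
    lra.
  lra.
rewrite leqW // leq_divRL //; apply: leq_trans (ltnW kr).
rewrite /swap_size -/h -!addnn; nia.
Qed.

Lemma local_search_ratio (p : nat) (alpha beta gamma eps : R)
    (X C : {fset T}) (k z : nat) v S :
  (forall a b : R, 0 <= a -> 0 <= b ->
     (2 * a + b) ^+ p - b ^+ p <= alpha * a ^+ p + beta * b ^+ p) ->
  0 <= alpha -> 0 <= beta -> 1 <= gamma -> 1 + alpha = gamma * (1 - beta) ->
  gamma <= 42 * (1 - beta) ->
  0 < eps -> C != fset0 -> (0 < k)%N ->
  returned v (out_cost p X z) eps (swap_size eps) C k S ->
  [/\ S `<=` C, within_budget eps k S
    & out_cost p X z S <= (gamma + eps) * OPT (out_cost p X z) C k].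
Proof.
move=> pw al0 be0 g1 ag gb e0 C0 k0 ret.
have [SC S0 Sb CS] := returned_inv e0 C0 k0 ret.
split=> //; first exact/within_budgetE.
have [O [OC O0 Ok ->]] := OPT_attained (out_cost p X z) C0 k0.
have cS0 := out_cost_ge0 p X z S0; have cO0 := out_cost_ge0 p X z O0.
(* Otherwise (1 + eps) k < |C|, which turns the slack eps / |C| per swap into at most eps / ((1 +
   eps) k). *)
case: (leqP #|` C| (budget eps k)) => [Cb|bC].
  apply: le_trans (CS Cb) _; apply: le_trans (out_cost_sub p X z O0 OC) _.
  by rewrite ler_peMl //; lra.
have opt := returned_swap_optimal e0 SC cS0 ret.
set eta := eps / _ in opt.
have k1 : 1 <= k%:R :> R by rewrite ler1n.
have b0 : 0 <= (1 + eps) * k%:R by rewrite mulr_ge0 // addr_ge0 // ltW.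
have bC' : (1 + eps) * k%:R < #|` C|%:R by rewrite -truncn_lt_nat.
have C0' : 0 < #|` C|%:R :> R by apply: le_lt_trans bC'.
have eta0 : 0 <= eta by rewrite divr_ge0 // ltW.
have etaC : eta * ((1 + eps) * k%:R) <= eps.
  rewrite /eta mulrAC ler_pdivrMr // ler_wpM2l // ltW //.
have kb : (k <= budget eps k)%N.
  by rewrite /budget truncn_ge_nat // ler_peMl // lerDl ltW.
case: (leqP k (swap_size eps)) => kr.
  have H := local_opt_small opt SC S0 Sb OC O0 Ok kb kr.
  (* This gives (1 + eps) (1 - eta) >= 1, so the single swap already yields the factor 1 + eps. *)
  have eta1 : eta * (1 + eps) <= eps.
    apply: le_trans etaC; rewrite ler_wpM2l // ler_peMr //; lra.
  apply: le_trans (_ : (1 + eps) * out_cost p X z O <= _); last first.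
    by rewrite ler_wpM2r //; lra.
  apply: le_trans (_ : (1 + eps) * ((1 - eta) * out_cost p X z S) <= _).
    by rewrite mulrA ler_peMl //; lra.
  by rewrite ler_wpM2l //; lra.
have [s1 s2] := swap_size_slack e0 kr.
have [||||N Nw H] := local_opt_bound pw al0 be0 _ s1 _ s2 _ _ opt SC S0 Sb OC O0 Ok.
- by [].
- by rewrite addnS ltnS leq_addr.
- by [].
- exact: leq_trans kb.
apply: (ratio_arith (k := k)) H => //.
case: N Nw => [|N] Nw; first by [].
apply: leq_trans (leq_div k (block_size eps)); rewrite -ltnS.
by apply: leq_trans _ Nw; rewrite ltn_mul2l /= ltn_addl.
Qed.
End LocalSearch.

Theorem theorem3 (R : realType) :
  exists (rho : R -> nat) (a : nat),
    (\forall eps \near (0 : R)^'+, (rho eps)%:R <= (1 / eps) ^+ a) /\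
    forall eps : R, 0 < eps ->
    forall (T : metricType R) (X C : {fset T}) (k z : nat) (v : variant),
      C != fset0 -> (1 <= k)%N ->
      (terminates v (kmedian_out_cost X z) eps (rho eps) C k /\
       forall S, returned v (kmedian_out_cost X z) eps (rho eps) C k S ->
         [/\ S `<=` C, within_budget eps k S &
             kmedian_out_cost X z S
               <= (3 + eps) * OPT (kmedian_out_cost X z) C k]) /\
      (terminates v (kmeans_out_cost X z) eps (rho eps) C k /\
       forall S, returned v (kmeans_out_cost X z) eps (rho eps) C k S ->
         [/\ S `<=` C, within_budget eps k S &
             kmeans_out_cost X z S
               <= (25 + eps) * OPT (kmeans_out_cost X z) C k]).
Proof.
exists (@swap_size R), 4%N; split.
  near=> eps; apply: swap_size_le; near: eps; first exact: nbhs_right_gt.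
  by apply: nbhs_right_le; lra.
move=> eps e0 T X C k z v C0 k0.
split; (split; first exact: swap_terminates) => S.
  apply: (@local_search_ratio _ _ 1 2 0) => //; try lra.
  by move=> a b a0 b0; rewrite !expr1; lra.
(* AM-GM gives 4 a b <= (4 / beta) a^2 + beta b^2, hence alpha = 4 + 4 / beta; beta = 2/5 minimises
   (1 + alpha) / (1 - beta), with value 25. *)
apply: (@local_search_ratio _ _ 2 14 (2 / 5)) => //; try lra.
move=> a b a0 b0; have := sqr_ge0 (5 * a - b); rewrite !expr2; lra.
Unshelve. all: by end_near.
Qed.
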